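(* Let $T$ be (the surface of) a regular tetrahedron with its intrinsic path metric. The space $T\times T$ cannot be partitioned as $E_1\sqcup E_2\sqcup E_3$ with a geodesic motion-planning rule on each $E_i$.
   Context: For a metric space $X$, let $P(X)$ denote the space of paths in $X$. A geodesic motion-planning rule (GMPR) on a subset $E\subseteq X\times X$ is a continuous function $\phi:E\to P(X)$ such that for every $(x_0,x_1)\in E$, $\phi(x_0,x_1)$ is a minimal (shortest) geodesic from $x_0$ to $x_1$. *)

(* Defs.v *)
From Stdlib Require Import Reals Lra List.
From Coquelicot Require Import Coquelicot.
Open Scope R_scope.

Definition pt : Type := (R * R * R)%type.

Definition eucl (p q : pt) : R :=
  let '(x1, y1, z1) := p in let '(x2, y2, z2) := q in
  sqrt ((x1 - x2)^2 + (y1 - y2)^2 + (z1 - z2)^2).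

Definition v1 : pt := (1, 1, 1).
Definition v2 : pt := (1, -1, -1).
Definition v3 : pt := (-1, 1, -1).
Definition v4 : pt := (-1, -1, 1).

Definition comb3 (a b c : R) (p q r : pt) : pt :=
  let '(p1, p2, p3) := p in let '(q1, q2, q3) := q in let '(r1, r2, r3) := r in
  (a*p1 + b*q1 + c*r1, a*p2 + b*q2 + c*r2, a*p3 + b*q3 + c*r3).

Definition in_triangle (p q r x : pt) : Prop :=
  exists a b c, 0 <= a /\ 0 <= b /\ 0 <= c /\ a + b + c = 1 /\ x = comb3 a b c p q r.

Definition inT (x : pt) : Prop :=
  in_triangle v1 v2 v3 x \/ in_triangle v1 v2 v4 x \/
  in_triangle v1 v3 v4 x \/ in_triangle v2 v3 v4 x.

Definition path_in_T (g : R -> pt) : Prop :=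
  (forall t, 0 <= t <= 1 -> inT (g t)) /\
  (forall t, 0 <= t <= 1 -> forall eps, 0 < eps -> exists delta, 0 < delta /\
     forall s, 0 <= s <= 1 -> Rabs (s - t) < delta -> eucl (g s) (g t) < eps).

Fixpoint chain_ok (a : R) (l : list R) : Prop :=
  match l with nil => True | b :: l' => a <= b /\ b <= 1 /\ chain_ok b l' end.
Fixpoint chain_len (g : R -> pt) (a : R) (l : list R) : R :=
  match l with nil => 0 | b :: l' => eucl (g a) (g b) + chain_len g b l' end.

Definition length_le (g : R -> pt) (L : R) : Prop :=
  forall l, chain_ok 0 l -> chain_len g 0 l <= L.

Definition dT (x y : pt) : R :=
  real (Glb_Rbar (fun L => exists g : R -> pt,
          g 0 = x /\ g 1 = y /\ path_in_T g /\ length_le g L)).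

Definition minimal_geodesic (x y : pt) (g : R -> pt) : Prop :=
  g 0 = x /\ g 1 = y /\
  (forall t, 0 <= t <= 1 -> inT (g t)) /\
  (forall s t, 0 <= s <= 1 -> 0 <= t <= 1 ->
     dT (g s) (g t) = Rabs (s - t) * dT x y).

(** Continuity of phi : E -> P(T), with the product metric on T x T and the
    compact-open (= uniform) topology on P(T). *)
Definition continuous_on_E (E : pt -> pt -> Prop) (phi : pt -> pt -> R -> pt) : Prop :=
  forall x y, E x y -> forall eps, 0 < eps -> exists delta, 0 < delta /\
    forall x' y', E x' y' -> dT x x' < delta -> dT y y' < delta ->
      forall t, 0 <= t <= 1 -> dT (phi x y t) (phi x' y' t) < eps.

Definition GMPR (E : pt -> pt -> Prop) (phi : pt -> pt -> R -> pt) : Prop :=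
  (forall x y, E x y -> minimal_geodesic x y (phi x y)) /\ continuous_on_E E phi.

Definition partition3 (E1 E2 E3 : pt -> pt -> Prop) : Prop :=
  (forall x y, (E1 x y \/ E2 x y \/ E3 x y) -> inT x /\ inT y) /\
  (forall x y, inT x -> inT y -> E1 x y \/ E2 x y \/ E3 x y) /\
  (forall x y, ~ (E1 x y /\ E2 x y)) /\
  (forall x y, ~ (E1 x y /\ E3 x y)) /\
  (forall x y, ~ (E2 x y /\ E3 x y)).

(* Main.v *)
Require Import Defs.
From Stdlib Require Import Reals Lra Lia List Classical.
From Coquelicot Require Import Coquelicot.
Import ListNotations.
Open Scope R_scope.

(** The plane x + y + z = -1 of a face folds onto T by a triangle wave in each
    coordinate. The folding is 1-Lipschitz, isometric on faces, and its fibres are the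
    orbits of a group of translations and half-turns, so paths in T lift to the plane
    without becoming longer, and dT x y is the distance from a lift of x to the set of
    lifts of y. Some pair (x, y) has exactly four minimal geodesics, with distinct
    midpoints, and nearby pairs can be chosen so that the four squared lengths change by
    four arbitrary small amounts. Start at this pair; the rule whose domain contains
    the current pair picks one of the remaining shortest types; lengthening that type by
    a tiny amount leaves, by continuity, this domain for good. Each step removes one type
    and one domain, and since four types can be removed one by one, three domains do not
    suffice. *)

(** * Euclidean distance and coordinatewise closeness in space *)

Definition dist2 (p q : pt) : R :=
  let '(x1, y1, z1) := p in let '(x2, y2, z2) := q in
  (x1 - x2)^2 + (y1 - y2)^2 + (z1 - z2)^2.

Lemma eucl_sqrt (p q : pt) : eucl p q = sqrt (dist2 p q).
Proof. destruct p as [[x y] z], q as [[x' y'] z']; reflexivity. Qed.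

Lemma dist2_ge_0 (p q : pt) : 0 <= dist2 p q.
Proof. destruct p as [[x y] z], q as [[x' y'] z']; cbn -[pow].
  pose proof (pow2_ge_0 (x - x')); pose proof (pow2_ge_0 (y - y')).
  pose proof (pow2_ge_0 (z - z')); lra.
Qed.

Lemma eucl_ge_0 (p q : pt) : 0 <= eucl p q.
Proof. rewrite eucl_sqrt; apply sqrt_pos. Qed.

Lemma eucl_sqr (p q : pt) : (eucl p q)^2 = dist2 p q.
Proof. rewrite eucl_sqrt; apply pow2_sqrt, dist2_ge_0. Qed.

Lemma eucl_le_sqr (p q : pt) (r : R) : 0 <= r -> dist2 p q <= r^2 -> eucl p q <= r.
Proof. intros Hr H; pose proof (eucl_sqr p q); pose proof (eucl_ge_0 p q); nra. Qed.

Lemma eucl_le_eucl (p q p' q' : pt) : dist2 p q <= dist2 p' q' -> eucl p q <= eucl p' q'.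
Proof. intros H; rewrite !eucl_sqrt; apply sqrt_le_1_alt, H. Qed.

Lemma eucl_refl (p : pt) : eucl p p = 0.
Proof.
  destruct p as [[x y] z]; rewrite eucl_sqrt; simpl.
  replace (_ + _ + _) with 0 by ring; apply sqrt_0.
Qed.

Lemma eucl_sym (p q : pt) : eucl p q = eucl q p.
Proof.
  rewrite !eucl_sqrt; f_equal.
  destruct p as [[x y] z], q as [[x' y'] z']; simpl; ring.
Qed.

Lemma eucl_triangle (p q r : pt) : eucl p r <= eucl p q + eucl q r.
Proof.
  pose proof (eucl_ge_0 p q) as Hx; pose proof (eucl_ge_0 q r) as Hy.
  apply eucl_le_sqr; [lra|].
  pose proof (eucl_sqr p q) as Ex; pose proof (eucl_sqr q r) as Ey.
  set (x := eucl p q) in *; set (y := eucl q r) in *; clearbody x y.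
  destruct p as [[p1 p2] p3], q as [[q1 q2] q3], r as [[r1 r2] r3]; simpl in *.
  set (a1 := p1 - q1) in *; set (a2 := p2 - q2) in *; set (a3 := p3 - q3) in *.
  set (b1 := q1 - r1) in *; set (b2 := q2 - r2) in *; set (b3 := q3 - r3) in *.
  replace (p1 - r1) with (a1 + b1) by (unfold a1, b1; ring).
  replace (p2 - r2) with (a2 + b2) by (unfold a2, b2; ring).
  replace (p3 - r3) with (a3 + b3) by (unfold a3, b3; ring).
  clearbody a1 a2 a3 b1 b2 b3.
  (* Cauchy-Schwarz: by Lagrange's identity the difference is the sum of the three squares posed
     below. *)
  assert (CS : (a1*b1 + a2*b2 + a3*b3)^2 <= (x*y)^2).
  { replace ((x*y)^2) with ((x*(x*1))*(y*(y*1))) by ring; rewrite Ex, Ey.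
    pose proof (pow2_ge_0 (a1*b2 - a2*b1)); pose proof (pow2_ge_0 (a1*b3 - a3*b1)).
    pose proof (pow2_ge_0 (a2*b3 - a3*b2)); nra. }
  assert (a1*b1 + a2*b2 + a3*b3 <= x*y).
  { assert (0 <= x*y) by (apply Rmult_le_pos; assumption); nra. }
  nra.
Qed.

Definition near (r : R) (p q : pt) : Prop :=
  let '(x1, y1, z1) := p in let '(x2, y2, z2) := q in
  Rabs (x1 - x2) < r /\ Rabs (y1 - y2) < r /\ Rabs (z1 - z2) < r.

Lemma Rabs_lt_of_sqr (x r : R) : 0 < r -> x^2 < r^2 -> Rabs x < r.
Proof. intros Hr H; rewrite <- (pow2_abs x) in H; pose proof (Rabs_pos x); nra. Qed.

Lemma near_of_dist2 (p q : pt) (r : R) : 0 < r -> dist2 p q < r^2 -> near r p q.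
Proof.
  destruct p as [[x y] z], q as [[x' y'] z']; cbn -[pow]; intros Hr H.
  pose proof (pow2_ge_0 (x - x')); pose proof (pow2_ge_0 (y - y')).
  pose proof (pow2_ge_0 (z - z')).
  repeat split; apply Rabs_lt_of_sqr; lra.
Qed.

Lemma near_of_eucl (p q : pt) (r : R) : eucl p q < r -> near r p q.
Proof.
  intros H; pose proof (eucl_ge_0 p q).
  apply near_of_dist2; [lra|]; rewrite <- eucl_sqr; nra.
Qed.

Lemma near_trans (p q r : pt) (d e : R) : near d p q -> near e q r -> near (d + e) p r.
Proof.
  destruct p as [[x y] z], q as [[x' y'] z'], r as [[x'' y''] z'']; simpl.
  intros (A1 & A2 & A3) (B1 & B2 & B3).
  apply Rabs_def2 in A1, A2, A3, B1, B2, B3.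
  repeat split; apply Rabs_def1; lra.
Qed.

(** * The folding map *)

(** The graph of the triangle wave as a relation: a value is certified by naming a branch and a
    period, with no fractional part to compute. *)
Definition folds (t x : R) : Prop :=
  -1 <= x <= 1 /\ exists k : Z, t = x + 4 * IZR k \/ t = 2 - x + 4 * IZR k.

(* The triangle wave of period 4 that is the identity on [-1, 1]. *)
Definition tri (t : R) : R := Rabs (4 * frac_part ((t - 1) / 4) - 2) - 1.

Lemma tri_folds (t : R) : folds t (tri t).
Proof.
  unfold folds, tri; destruct (base_fp ((t - 1) / 4)) as [H0 H1].
  unfold frac_part in *; set (n := Int_part ((t - 1) / 4)) in *; clearbody n.
  destruct (Rle_dec 2 (4 * ((t - 1) / 4 - IZR n))) as [H | H].
  - rewrite Rabs_pos_eq by lra; split; [lra|].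
    exists (n + 1)%Z; left; rewrite plus_IZR; lra.
  - rewrite Rabs_left by lra; split; [lra|].
    exists n; right; lra.
Qed.

(** On equal branches, distinct periods put [s] and [t] at least 2 apart, and [Rabs (x - y) <= 2].
    On opposite branches the nearest cases have distance [(1 - x) + (1 - y)] or
    [(1 + x) + (1 + y)]. *)
Lemma folds_lipschitz (s t x y : R) : folds s x -> folds t y -> Rabs (x - y) <= Rabs (s - t).
Proof.
  intros [Hx (k & Hk)] [Hy (l & Hl)].
  assert (D : IZR k - IZR l <= -2 \/ IZR k - IZR l = -1 \/ IZR k - IZR l = 0
              \/ IZR k - IZR l = 1 \/ 2 <= IZR k - IZR l).
  { rewrite <- minus_IZR; set (n := (k - l)%Z).
    assert (n <= -2 \/ n = -1 \/ n = 0 \/ n = 1 \/ 2 <= n)%Z as [H | [H | [H | [H | H]]]] by lia.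
    2, 3, 4: rewrite H; lra.
    all: apply IZR_le in H; lra. }
  apply Rabs_le.
  unfold Rabs; destruct (Rcase_abs (s - t)); destruct Hk, Hl; lra.
Qed.

Lemma tri_lipschitz (s t : R) : Rabs (tri s - tri t) <= Rabs (s - t).
Proof. apply folds_lipschitz; apply tri_folds. Qed.

Lemma tri_unique (t x : R) : folds t x -> tri t = x.
Proof.
  intros H; pose proof (folds_lipschitz _ _ _ _ (tri_folds t) H) as L.
  rewrite Rminus_diag, Rabs_R0 in L; pose proof (Rabs_pos (tri t - x)).
  apply Rminus_diag_uniq; destruct (Req_dec (tri t - x) 0) as [E | E]; [exact E|].
  apply Rabs_no_R0 in E; lra.
Qed.

Lemma tri_eq_cases (s t : R) : tri s = tri t ->
  exists k : Z, t = s + 4 * IZR k \/ t = 2 - s + 4 * IZR k.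
Proof.
  intros E; destruct (tri_folds s) as [_ (k & Hk)], (tri_folds t) as [_ (l & Hl)].
  rewrite E in Hk; destruct Hk as [Hk | Hk], Hl as [Hl | Hl].
  1, 4: exists (l - k)%Z; left; rewrite minus_IZR; lra.
  all: exists (l + k)%Z; right; rewrite plus_IZR; lra.
Qed.

(* The universal (orbifold) cover of the tetrahedron: its face [x + y + z = -1]
   spans the plane [onH], and folding the plane onto T is [tri] in each coordinate. *)
Definition onH (p : pt) : Prop := let '(x, y, z) := p in x + y + z = -1.

Definition foldT (p : pt) : pt := let '(x, y, z) := p in (tri x, tri y, tri z).

Lemma sqr_le_of_Rabs (x y : R) : Rabs x <= Rabs y -> x^2 <= y^2.
Proof. intros H; apply Rsqr_le_abs_1 in H; unfold Rsqr in H; nra. Qed.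

Lemma foldT_lipschitz (p q : pt) : eucl (foldT p) (foldT q) <= eucl p q.
Proof.
  apply eucl_le_eucl; destruct p as [[x y] z], q as [[x' y'] z']; cbn -[pow].
  pose proof (sqr_le_of_Rabs _ _ (tri_lipschitz x x')).
  pose proof (sqr_le_of_Rabs _ _ (tri_lipschitz y y')).
  pose proof (sqr_le_of_Rabs _ _ (tri_lipschitz z z')); lra.
Qed.

Lemma foldT_near (p q : pt) (r : R) : near r p q -> near r (foldT p) (foldT q).
Proof.
  destruct p as [[x y] z], q as [[x' y'] z']; simpl.
  pose proof (tri_lipschitz x x'); pose proof (tri_lipschitz y y').
  pose proof (tri_lipschitz z z'); lra.
Qed.

(** * The faces of the tetrahedron inside the cube, and their unfolding *)

Definition cube (p : pt) : Prop :=
  let '(x, y, z) := p in -1 <= x <= 1 /\ -1 <= y <= 1 /\ -1 <= z <= 1.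

Definition face (i : nat) (p : pt) : Prop :=
  let '(x, y, z) := p in
  match i with
  | 0%nat => x + y + z = -1
  | 1%nat => x - y - z = -1
  | 2%nat => - x + y - z = -1
  | _ => - x - y + z = -1
  end.

(** The vertices are alternate corners of the cube; on a face plane the barycentric coordinates are
    half the distances to three sides of the cube. *)
Lemma inT_iff (p : pt) : inT p <-> cube p /\ exists i, face i p.
Proof.
  destruct p as [[x y] z]; unfold inT, in_triangle; split.
  - intros [H | [H | [H | H]]]; destruct H as (a & b & c & Ha & Hb & Hc & Hs & H);
      simpl in H; injection H as -> -> ->; (split; [simpl; lra|]).
    + exists 3%nat; simpl; lra.
    + exists 2%nat; simpl; lra.
    + exists 1%nat; simpl; lra.
    + exists 0%nat; simpl; lra.
  - intros [(Hx & Hy & Hz) (i & Hi)].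
    destruct i as [|[|[|i]]]; simpl in Hi.
    + do 3 right; exists ((1 + x)/2), ((1 + y)/2), ((1 + z)/2).
      repeat split; try lra; simpl; repeat f_equal; lra.
    + do 2 right; left; exists ((1 + x)/2), ((1 - z)/2), ((1 - y)/2).
      repeat split; try lra; simpl; repeat f_equal; lra.
    + right; left; exists ((1 + y)/2), ((1 - z)/2), ((1 - x)/2).
      repeat split; try lra; simpl; repeat f_equal; lra.
    + left; exists ((1 + z)/2), ((1 - y)/2), ((1 - x)/2).
      repeat split; try lra; simpl; repeat f_equal; lra.
Qed.

Lemma foldT_inT (p : pt) : onH p -> inT (foldT p).
Proof.
  destruct p as [[a b] c]; intros H; simpl in H; apply inT_iff; simpl.
  destruct (tri_folds a) as [Ha (k & Hk)], (tri_folds b) as [Hb (l & Hl)],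
    (tri_folds c) as [Hc (m & Hm)].
  set (x := tri a) in *; set (y := tri b) in *; set (z := tri c) in *; clearbody x y z.
  split; [lra|].
  set (n := (k + l + m)%Z).
  assert (En : IZR n = IZR k + IZR l + IZR m) by (unfold n; rewrite !plus_IZR; ring).
  clearbody n.
  (* For each choice of branches, [n] fixes a signed sum of [x], [y], [z]: it is 1 or -1 on a face,
     and 3 or -3 only at a vertex. *)
  assert (Hn : (n = -2 \/ n = -1 \/ n = 0)%Z).
  { assert (-3 < IZR n < 1) as [L1 L2] by (destruct Hk, Hl, Hm; lra).
    apply (lt_IZR (-3)) in L1; apply (lt_IZR _ 1) in L2; lia. }
  destruct Hn as [-> | [-> | ->]]; destruct Hk, Hl, Hm; try lra;
    solve [exists 0%nat; lra | exists 1%nat; lra | exists 2%nat; lra | exists 3%nat; lra].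
Qed.

(** For [i > 0], reflecting one coordinate at 1 and another at -1 is a half-turn of space that
    carries the face into [onH]; the wave is symmetric about both values, so folding undoes it. *)
Definition unfold_face (i : nat) (p : pt) : pt :=
  let '(x, y, z) := p in
  match i with
  | 0%nat => (x, y, z)
  | 1%nat => (x, 2 - y, -2 - z)
  | 2%nat => (-2 - x, y, 2 - z)
  | _ => (2 - x, -2 - y, z)
  end.

Lemma unfold_face_onH (i : nat) (p : pt) : face i p -> onH (unfold_face i p).
Proof. destruct p as [[x y] z], i as [|[|[|i]]]; simpl; lra. Qed.

Lemma foldT_unfold_face (i : nat) (p : pt) : cube p -> foldT (unfold_face i p) = p.
Proof.
  assert (A : forall t, -1 <= t <= 1 -> tri t = t).
  { intros t Ht; apply tri_unique; split; [exact Ht|]; exists 0%Z; lra. }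
  assert (B : forall t, -1 <= t <= 1 -> tri (2 - t) = t).
  { intros t Ht; apply tri_unique; split; [exact Ht|]; exists 0%Z; lra. }
  assert (C : forall t, -1 <= t <= 1 -> tri (-2 - t) = t).
  { intros t Ht; apply tri_unique; split; [exact Ht|]; exists (-1)%Z; lra. }
  destruct p as [[x y] z]; intros (Hx & Hy & Hz).
  destruct i as [|[|[|i]]]; simpl;
    repeat f_equal; solve [apply A; assumption | apply B; assumption | apply C; assumption].
Qed.

Lemma unfold_face_eucl (i : nat) (p q : pt) :
  eucl (unfold_face i p) (unfold_face i q) = eucl p q.
Proof.
  rewrite !eucl_sqrt; f_equal.
  destruct p as [[x y] z], q as [[x' y'] z'], i as [|[|[|i]]]; simpl; ring.
Qed.

Lemma foldT_surj (p : pt) : inT p -> exists a, onH a /\ foldT a = p.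
Proof.
  rewrite inT_iff; intros [Hc (i & Hi)]; exists (unfold_face i p).
  split; [apply unfold_face_onH | apply foldT_unfold_face]; assumption.
Qed.

(* Deck transformations: translations ([s = 1]) and half-turns ([s = -1]). *)
Definition deck (s : R) (k l m : Z) (p : pt) : pt :=
  let '(x, y, z) := p in
  (s * x + (1 - s) + 4 * IZR k, s * y + (1 - s) + 4 * IZR l, s * z + (1 - s) + 4 * IZR m).

Definition sign (s : R) : Prop := s = 1 \/ s = -1.

Lemma tri_deck (s t : R) (k : Z) : sign s -> tri (s * t + (1 - s) + 4 * IZR k) = tri t.
Proof.
  intros Hs; apply tri_unique; destruct (tri_folds t) as [H (l & Hl)]; split; [exact H|].
  destruct Hs as [-> | ->]; [exists (k + l)%Z | exists (k - l)%Z];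
    rewrite ?plus_IZR, ?minus_IZR; destruct Hl; lra.
Qed.

Lemma foldT_deck (s : R) (k l m : Z) (p : pt) : sign s -> foldT (deck s k l m p) = foldT p.
Proof. intros Hs; destruct p as [[x y] z]; simpl; rewrite !tri_deck by exact Hs; reflexivity. Qed.

Lemma deck_eucl (s : R) (k l m : Z) (p q : pt) : sign s ->
  eucl (deck s k l m p) (deck s k l m q) = eucl p q.
Proof.
  intros Hs; rewrite !eucl_sqrt; f_equal.
  destruct p as [[x y] z], q as [[x' y'] z'], Hs as [-> | ->]; simpl; ring.
Qed.

(** The coordinate sum of the image depends only on that of the point, so one point decides for the
    whole plane. *)
Lemma deck_onH (s : R) (k l m : Z) (p q : pt) :
  onH p -> onH (deck s k l m p) -> onH q -> onH (deck s k l m q).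
Proof.
  destruct p as [[x y] z], q as [[x' y'] z']; simpl; intros Hp Hd Hq.
  replace x with (-1 - y - z) in Hd by lra; replace x' with (-1 - y' - z') by lra; lra.
Qed.

Lemma foldT_fiber (p q : pt) : onH p -> onH q -> foldT p = foldT q ->
  exists s k l m, sign s /\ q = deck s k l m p.
Proof.
  destruct p as [[x y] z], q as [[x' y'] z']; simpl; intros Hp Hq E.
  injection E as E1 E2 E3.
  apply tri_eq_cases in E1, E2, E3.
  destruct E1 as (k & E1), E2 as (l & E2), E3 as (m & E3).
  assert (A : forall s k l m, sign s -> x' = s*x + (1-s) + 4*IZR k ->
    y' = s*y + (1-s) + 4*IZR l -> z' = s*z + (1-s) + 4*IZR m ->
    exists s k l m, sign s /\ (x', y', z') =
      (s * x + (1 - s) + 4 * IZR k, s * y + (1 - s) + 4 * IZR l, s * z + (1 - s) + 4 * IZR m)).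
  { intros s k' l' m' Hs -> -> ->; exists s, k', l', m'; auto. }
  (* With mixed signs the coordinate in the minority is an odd integer,
     so it is moved the same way by a map of the other sign. *)
  pose (n := (k + l + m)%Z).
  destruct E1 as [E1 | E1], E2 as [E2 | E2], E3 as [E3 | E3].
  - apply (A 1 k l m); [left; reflexivity | lra ..].
  (* The sum conditions force [z = 1 + 2 * n] here; with two reflected coordinates, the remaining
     one is [-3 - 2 * n]. *)
  - apply (A 1 k l (m - n)%Z); [left; reflexivity | ..];
      unfold n; rewrite ?minus_IZR, ?plus_IZR; lra.
  - apply (A 1 k (l - n)%Z m); [left; reflexivity | ..];
      unfold n; rewrite ?minus_IZR, ?plus_IZR; lra.
  - apply (A (-1) (k - n - 2)%Z l m); [right; reflexivity | ..];
      unfold n; rewrite ?minus_IZR, ?plus_IZR; lra.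
  - apply (A 1 (k - n)%Z l m); [left; reflexivity | ..];
      unfold n; rewrite ?minus_IZR, ?plus_IZR; lra.
  - apply (A (-1) k (l - n - 2)%Z m); [right; reflexivity | ..];
      unfold n; rewrite ?minus_IZR, ?plus_IZR; lra.
  - apply (A (-1) k l (m - n - 2)%Z); [right; reflexivity | ..];
      unfold n; rewrite ?minus_IZR, ?plus_IZR; lra.
  - apply (A (-1) k l m); [right; reflexivity | lra ..].
Qed.

(** * Lengths of paths *)

(** Unfolding the common face lifts both points isometrically; a deck transformation then moves the
    lift of [p] to [b]. *)
Lemma lift_step (i : nat) (p q b : pt) :
  cube p -> face i p -> cube q -> face i q -> onH b -> foldT b = p ->
  exists b', onH b' /\ foldT b' = q /\ eucl b b' = eucl p q.
Proof.
  intros Cp Fp Cq Fq Hb Eb.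
  pose proof (unfold_face_onH i p Fp) as Hp; pose proof (unfold_face_onH i q Fq) as Hq.
  destruct (foldT_fiber _ b Hp Hb) as (s & k & l & m & Hs & ->).
  { rewrite foldT_unfold_face by exact Cp; auto. }
  exists (deck s k l m (unfold_face i q)); split; [|split].
  - exact (deck_onH _ _ _ _ _ _ Hp Hb Hq).
  - rewrite foldT_deck by exact Hs; apply foldT_unfold_face, Cq.
  - rewrite deck_eucl by exact Hs; apply unfold_face_eucl.
Qed.

Lemma face_closed (i : nat) (p : pt) :
  exists d, 0 < d /\ forall q, eucl p q < d -> face i q -> face i p.
Proof.
  destruct p as [[x y] z].
  pose (e := match i with 0%nat => x + y + z + 1 | 1%nat => x - y - z + 1
             | 2%nat => - x + y - z + 1 | _ => - x - y + z + 1 end).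
  destruct (Req_dec e 0) as [E | E].
  - exists 1; split; [lra|]; intros _ _ _.
    destruct i as [|[|[|i]]]; simpl; unfold e in E; lra.
  (* [e] is affine with coefficients 1 or -1, so moving each coordinate by less than [Rabs e / 3]
     cannot bring it to 0. *)
  - exists (Rabs e / 3); pose proof (Rabs_pos_lt e E); split; [lra|].
    intros [[x' y'] z'] H1 H2; exfalso; apply near_of_eucl in H1.
    destruct H1 as (A & B & C); apply Rabs_def2 in A, B, C.
    revert A B C; unfold Rabs in *; destruct (Rcase_abs e); intros;
      destruct i as [|[|[|i]]]; simpl in H2; unfold e in *; lra.
Qed.

(* Faces are closed and finitely many, so points near [p] lie on faces through [p]. *)
Lemma common_face (p : pt) : exists d, 0 < d /\
  forall q, inT q -> eucl p q < d -> exists i, face i p /\ face i q.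
Proof.
  destruct (face_closed 0 p) as (d0 & H0 & F0), (face_closed 1 p) as (d1 & H1 & F1),
    (face_closed 2 p) as (d2 & H2 & F2), (face_closed 3 p) as (d3 & H3 & F3).
  exists (Rmin (Rmin d0 d1) (Rmin d2 d3)); split; [repeat apply Rmin_glb_lt; assumption|].
  intros q Hq L.
  pose proof (Rmin_l (Rmin d0 d1) (Rmin d2 d3)); pose proof (Rmin_r (Rmin d0 d1) (Rmin d2 d3)).
  pose proof (Rmin_l d0 d1); pose proof (Rmin_r d0 d1).
  pose proof (Rmin_l d2 d3); pose proof (Rmin_r d2 d3).
  apply inT_iff in Hq; destruct Hq as [_ (i & Hi)]; exists i; split; [|exact Hi].
  destruct i as [|[|[|i]]].
  - apply (F0 q); [lra | exact Hi].
  - apply (F1 q); [lra | exact Hi].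
  - apply (F2 q); [lra | exact Hi].
  - destruct p as [[x y] z], q as [[x' y'] z']; apply (F3 (x', y', z')); [lra | exact Hi].
Qed.

(** Both directions serve the supremum argument below: lifting into [p] reaches the supremum,
    lifting out of [p] passes it. *)
Lemma lift_close (p : pt) : inT p -> exists d, 0 < d /\ forall q, inT q -> eucl p q < d ->
  (forall b, onH b -> foldT b = p ->
     exists b', onH b' /\ foldT b' = q /\ eucl b b' = eucl p q) /\
  (forall b, onH b -> foldT b = q ->
     exists b', onH b' /\ foldT b' = p /\ eucl b b' = eucl q p).
Proof.
  intros Hp; destruct (common_face p) as (d & Hd & F); exists d; split; [exact Hd|].
  intros q Hq L; destruct (F q Hq L) as (i & Fp & Fq).
  apply inT_iff in Hp, Hq; destruct Hp as [Cp _], Hq as [Cq _].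
  split; intros b; apply (lift_step i); assumption.
Qed.

Lemma last_cons {A : Type} (l : list A) (a b : A) : last (b :: l) a = last l b.
Proof.
  revert a b; induction l as [|c l IH]; intros a b; [reflexivity|].
  exact (eq_trans (IH a c) (eq_sym (IH b c))).
Qed.

Lemma chain_snoc (g : R -> pt) (t : R) (l : list R) (a : R) :
  chain_ok a l -> last l a <= t <= 1 ->
  chain_ok a (l ++ [t]) /\ last (l ++ [t]) a = t /\
  chain_len g a (l ++ [t]) = chain_len g a l + eucl (g (last l a)) (g t).
Proof.
  revert a; induction l as [|b l IH]; intros a H1 H2.
  - simpl in *; repeat split; try lra; apply H2.
  - rewrite last_cons in *; simpl app; rewrite last_cons; simpl in *.
    destruct H1 as (A & B & C), (IH b C H2) as (D & E & F).
    repeat split; try assumption; rewrite F; ring.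
Qed.

Lemma chain_ok_last (l : list R) (a : R) : chain_ok a l -> a <= 1 -> a <= last l a <= 1.
Proof.
  revert a; induction l as [|b l IH]; intros a H Ha; [simpl; lra|].
  rewrite last_cons; destruct H as (A & B & C); specialize (IH b C B); lra.
Qed.

(** Continuous induction on the times [t] for which some chain ending at [t] is at least as long as
    the distance from [a] to some lift of [g t]. The supremum of these times is itself such a time
    and equals 1. *)
Lemma path_lift (g : R -> pt) (L : R) (a : pt) :
  path_in_T g -> length_le g L -> onH a -> foldT a = g 0 ->
  exists b, onH b /\ foldT b = g 1 /\ eucl a b <= L.
Proof.
  intros [Hin Hcont] HL Ha Ea.
  pose (reach t := exists l, chain_ok 0 l /\ last l 0 = t /\
    exists b, onH b /\ foldT b = g t /\ eucl a b <= chain_len g 0 l).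
  assert (Hext : forall s t, reach s -> s <= t <= 1 ->
    (forall b, onH b -> foldT b = g s ->
       exists b', onH b' /\ foldT b' = g t /\ eucl b b' = eucl (g s) (g t)) -> reach t).
  { intros s t (l & Hl & <- & b & Hb & Eb & Lb) Hst Hlift.
    destruct (Hlift b Hb Eb) as (b' & Hb' & Eb' & Lb').
    destruct (chain_snoc g t l 0 Hl Hst) as (A & B & C).
    exists (l ++ [t]); split; [exact A|]; split; [exact B|].
    exists b'; split; [exact Hb'|]; split; [exact Eb'|].
    rewrite C, <- Lb'; pose proof (eucl_triangle a b b'); lra. }
  assert (Hdom : forall t, reach t -> 0 <= t <= 1).
  { intros t (l & Hl & <- & _); apply chain_ok_last; [exact Hl | lra]. }
  assert (H0 : reach 0).
  { exists []; repeat split; exists a; rewrite eucl_refl; simpl; repeat split; auto with real. }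
  destruct (completeness reach) as [s [Hub Hlub]].
  { exists 1; intros t Ht; apply Hdom in Ht; lra. }
  { exists 0; exact H0. }
  assert (Hs : 0 <= s <= 1).
  { split; [apply Hub, H0 | apply Hlub; intros t Ht; apply Hdom in Ht; lra]. }
  destruct (lift_close (g s) (Hin s Hs)) as (e & He & Hlift).
  destruct (Hcont s Hs e He) as (d & Hd & Hgd).
  assert (Hclose : forall t, 0 <= t <= 1 -> Rabs (t - s) < d -> eucl (g s) (g t) < e).
  { intros t Ht Hts; rewrite eucl_sym; apply Hgd; assumption. }
  assert (Hrs : reach s).
  { destruct (classic (exists t, reach t /\ s - d < t)) as [(t & Ht & Hst) | N].
    - pose proof (Hub t Ht); pose proof (Hdom t Ht).
      apply (Hext t s Ht); [lra|].
      apply (Hlift (g t)); [apply Hin; lra | apply Hclose; [lra|]].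
      apply Rabs_def1; lra.
    - exfalso; assert (s <= s - d); [|lra].
      apply Hlub; intros t Ht; destruct (Rle_dec t (s - d)); [assumption|].
      exfalso; apply N; exists t; split; [assumption | lra]. }
  assert (Es : s = 1).
  { destruct (Rlt_dec s 1) as [Hs1 |]; [exfalso | lra].
    pose proof (Rmin_l 1 (s + d / 2)); pose proof (Rmin_r 1 (s + d / 2)).
    assert (s < Rmin 1 (s + d / 2)) by (apply Rmin_glb_lt; lra).
    set (t := Rmin 1 (s + d / 2)) in *.
    assert (reach t) as Ht; [|apply Hub in Ht; lra].
    apply (Hext s t Hrs); [lra|].
    apply (Hlift (g t)); [apply Hin; lra | apply Hclose; [lra|]].
    apply Rabs_def1; lra. }
  subst s; destruct Hrs as (l & Hl & _ & b & Hb & Eb & Lb).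
  exists b; repeat split; [assumption .. | pose proof (HL l Hl); lra].
Qed.

(** * Folded segments and the intrinsic distance *)

Definition segment (a b : pt) (t : R) : pt :=
  let '(a1, a2, a3) := a in let '(b1, b2, b3) := b in
  (a1 + t * (b1 - a1), a2 + t * (b2 - a2), a3 + t * (b3 - a3)).

Lemma segment_eucl (a b : pt) (s t : R) :
  eucl (segment a b s) (segment a b t) = Rabs (s - t) * eucl a b.
Proof.
  rewrite (eucl_sqrt a b), <- (sqrt_Rsqr_abs (s - t)), <- sqrt_mult_alt by apply Rle_0_sqr.
  rewrite eucl_sqrt; f_equal; unfold Rsqr.
  destruct a as [[a1 a2] a3], b as [[b1 b2] b3]; simpl; ring.
Qed.

Lemma segment_0 (a b : pt) : segment a b 0 = a.
Proof. destruct a as [[a1 a2] a3], b as [[b1 b2] b3]; simpl; repeat f_equal; ring. Qed.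

Lemma segment_1 (a b : pt) : segment a b 1 = b.
Proof. destruct a as [[a1 a2] a3], b as [[b1 b2] b3]; simpl; repeat f_equal; ring. Qed.

Lemma segment_onH (a b : pt) (t : R) : onH a -> onH b -> onH (segment a b t).
Proof.
  destruct a as [[a1 a2] a3], b as [[b1 b2] b3]; simpl; intros Ha Hb.
  replace a1 with (-1 - a2 - a3) by lra; replace b1 with (-1 - b2 - b3) by lra; ring.
Qed.

Definition fold_segment (a b : pt) (t : R) : pt := foldT (segment a b t).

Lemma fold_segment_eucl (a b : pt) (s t : R) :
  eucl (fold_segment a b s) (fold_segment a b t) <= Rabs (s - t) * eucl a b.
Proof. rewrite <- segment_eucl; apply foldT_lipschitz. Qed.

Lemma fold_segment_path (a b : pt) : onH a -> onH b -> path_in_T (fold_segment a b).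
Proof.
  intros Ha Hb; split.
  - intros t _; apply foldT_inT, segment_onH; assumption.
  - intros t _ eps Heps; pose proof (eucl_ge_0 a b).
    exists (eps / (1 + eucl a b)); split; [apply Rdiv_lt_0_compat; lra|].
    intros s _ Hs; eapply Rle_lt_trans; [apply fold_segment_eucl|].
    apply Rlt_div_r in Hs; [|lra]; pose proof (Rabs_pos (s - t)); nra.
Qed.

Lemma fold_segment_length (a b : pt) : length_le (fold_segment a b) (eucl a b).
Proof.
  assert (A : forall l s, s <= 1 -> chain_ok s l ->
    chain_len (fold_segment a b) s l <= (1 - s) * eucl a b).
  { pose proof (eucl_ge_0 a b).
    induction l as [|t l IH]; intros s Hs Hl; simpl; [nra|].
    destruct Hl as (H1 & H2 & H3); specialize (IH t H2 H3).
    pose proof (fold_segment_eucl a b s t) as Hst.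
    rewrite Rabs_left1 in Hst by lra; lra. }
  intros l Hl; specialize (A l 0 ltac:(lra) Hl); lra.
Qed.

Definition path_length_bound (x y : pt) (L : R) : Prop :=
  exists g : R -> pt, g 0 = x /\ g 1 = y /\ path_in_T g /\ length_le g L.

(** [real] sends infinite values to 0, so finiteness has to be shown: a folded segment bounds the
    infimum above, and the empty chain makes every length bound nonnegative. *)
Lemma dT_glb (x y : pt) : inT x -> inT y ->
  is_glb_Rbar (path_length_bound x y) (dT x y).
Proof.
  intros Hx Hy; unfold dT; fold (path_length_bound x y).
  pose proof (Glb_Rbar_correct (path_length_bound x y)) as [Hlb Hglb].
  destruct (foldT_surj x Hx) as (a & Ha & Ea), (foldT_surj y Hy) as (b & Hb & Eb).
  assert (N : path_length_bound x y (eucl a b)).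
  { exists (fold_segment a b); unfold fold_segment at 1 2; rewrite segment_0, segment_1.
    split; [exact Ea|]; split; [exact Eb|].
    split; [apply fold_segment_path; assumption | apply fold_segment_length]. }
  assert (P : Rbar_le 0 (Glb_Rbar (path_length_bound x y))).
  { apply Hglb; intros L (g & _ & _ & _ & HL); exact (HL [] I). }
  pose proof (Hlb _ N) as Q.
  change (is_glb_Rbar (path_length_bound x y) (Finite (real (Glb_Rbar (path_length_bound x y))))).
  destruct (Glb_Rbar (path_length_bound x y)) eqn:E; simpl in *; try contradiction.
  rewrite <- E; apply Glb_Rbar_correct.
Qed.

Lemma dT_le_eucl_lift (a b : pt) : onH a -> onH b -> dT (foldT a) (foldT b) <= eucl a b.
Proof.
  intros Ha Hb; destruct (dT_glb _ _ (foldT_inT a Ha) (foldT_inT b Hb)) as [H _].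
  apply (H (eucl a b)); exists (fold_segment a b); unfold fold_segment at 1 2.
  rewrite segment_0, segment_1; split; [reflexivity|]; split; [reflexivity|].
  split; [apply fold_segment_path; assumption | apply fold_segment_length].
Qed.

Lemma eucl_le_dT (x y : pt) : inT x -> inT y -> eucl x y <= dT x y.
Proof.
  intros Hx Hy; destruct (dT_glb x y Hx Hy) as [_ H].
  apply (H (eucl x y)); intros L (g & <- & <- & _ & HL).
  specialize (HL [1]); simpl in *; lra.
Qed.

(** Lifting an almost shortest path gives the converse of [dT_le_eucl_lift], with [eps] in place of
    attainment of the infimum. *)
Lemma lift_almost_minimal (a y : pt) (eps : R) : onH a -> inT y -> 0 < eps ->
  exists b, onH b /\ foldT b = y /\ eucl a b < dT (foldT a) y + eps.
Proof.
  intros Ha Hy Heps; destruct (dT_glb _ _ (foldT_inT a Ha) Hy) as [_ H].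
  destruct (classic (exists L, path_length_bound (foldT a) y L /\
    L < dT (foldT a) y + eps)) as [(L & (g & G0 & G1 & Gp & GL) & HL) | N].
  - destruct (path_lift g L a Gp GL Ha (eq_sym G0)) as (b & Hb & Eb & Lb).
    exists b; repeat split; [assumption | congruence | lra].
  - exfalso; assert (Rbar_le (dT (foldT a) y + eps) (dT (foldT a) y)) as C.
    { apply H; intros L HL; simpl; apply Rnot_lt_le; intros C; apply N; exists L; auto. }
    simpl in C; lra.
Qed.

(** * Pairs of points with four competing geodesics *)

Lemma pt_eq (x y z x' y' z' : R) : x = x' -> y = y' -> z = z' -> (x, y, z) = (x', y', z').
Proof. intros -> -> ->; reflexivity. Qed.

(** The solution [s], [h] of [2 * (2 + s)^2 + 6 * h^2 = 19/2 + p] and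
    [2 * (2 - s)^2 + 6 * h^2 = 19/2 + q]: subtracting gives [s], adding gives [h]. *)
Definition skew (p q : R) : R := (p - q) / 16.
Definition height (p q : R) : R := sqrt ((3/2 + (p + q)/2 - 2 * (skew p q)^2) / 6).

(* With [s = skew p q] and [h = height p q], the vector
   [(2 + s + h, - 2 - s + h, - 2 h)] has squared distance [19/2 + p] to the origin
   and [19/2 + q] to the period [(4, -4, 0)]. The displacements from a lift of
   [start t] to the lifts of [finish t] are of this form, with [p, q] equal to
   [t 0, t 1] for translates, and, up to a cyclic shift of the coordinates,
   to [t 2, t 3] for half-turned ones. *)
Definition start (t : nat -> R) : pt :=
  let s := skew (t 0%nat) (t 1%nat) in let h := height (t 0%nat) (t 1%nat) in
  let s' := skew (t 2%nat) (t 3%nat) in let h' := height (t 2%nat) (t 3%nat) in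
  ((4 + s + h - 2*h')/2, (-2 - s + h + s' + h')/2, (-4 - 2*h - s' + h')/2).

Definition finish (t : nat -> R) : pt :=
  let s := skew (t 0%nat) (t 1%nat) in let h := height (t 0%nat) (t 1%nat) in
  let s' := skew (t 2%nat) (t 3%nat) in let h' := height (t 2%nat) (t 3%nat) in
  ((-s - h - 2*h')/2, (2 + s - h + s' + h')/2, (-4 + 2*h - s' + h')/2).

Definition finish_lift (t : nat -> R) (k : nat) : pt :=
  let '(x, y, z) := finish t in
  match k with
  | 0%nat => (x, y, z)
  | 1%nat => (x + 4, y - 4, z)
  | 2%nat => (2 - x, -2 - y, -2 - z)
  | _ => (2 - x, 2 - y, -6 - z)
  end.

(* Midpoints of the four geodesics for [t = 0], in the plane and on T. *)
Definition mid_lift (k : nat) : pt :=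
  match k with
  | 0%nat => (1/2, 1/4, -7/4)
  | 1%nat => (5/2, -7/4, -7/4)
  | 2%nat => (9/4, -7/4, -3/2)
  | _ => (9/4, 1/4, -7/2)
  end.

Definition mid (k : nat) : pt := foldT (mid_lift k).

(** Any two midpoints differ by at least 1/4 in some coordinate; types 1 and 2 attain this bound. *)
Lemma mid_inj (p : pt) (d e : R) (j k : nat) : d + e <= 1/4 ->
  (j < 4)%nat -> (k < 4)%nat -> near d p (mid j) -> near e p (mid k) -> j = k.
Proof.
  assert (A : forall t x k, -1 <= x <= 1 -> t = x + 4 * IZR k -> tri t = x).
  { intros u x l H E; apply tri_unique; split; [exact H|]; exists l; lra. }
  assert (B : forall t x k, -1 <= x <= 1 -> t = 2 - x + 4 * IZR k -> tri t = x).
  { intros u x l H E; apply tri_unique; split; [exact H|]; exists l; lra. }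
  assert (E0 : mid 0 = (1/2, 1/4, -1/4)).
  { unfold mid; simpl; apply pt_eq.
    - apply (A _ _ 0%Z); lra.
    - apply (A _ _ 0%Z); lra.
    - apply (B _ _ (-1)%Z); lra. }
  assert (E1 : mid 1 = (-1/2, -1/4, -1/4)).
  { unfold mid; simpl; apply pt_eq.
    - apply (B _ _ 0%Z); lra.
    - apply (B _ _ (-1)%Z); lra.
    - apply (B _ _ (-1)%Z); lra. }
  assert (E2 : mid 2 = (-1/4, -1/4, -1/2)).
  { unfold mid; simpl; apply pt_eq.
    - apply (B _ _ 0%Z); lra.
    - apply (B _ _ (-1)%Z); lra.
    - apply (B _ _ (-1)%Z); lra. }
  assert (E3 : mid 3 = (-1/4, 1/4, 1/2)).
  { unfold mid; simpl; apply pt_eq.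
    - apply (B _ _ 0%Z); lra.
    - apply (A _ _ 0%Z); lra.
    - apply (A _ _ (-1)%Z); lra. }
  destruct p as [[x y] z]; intros Hde Hj Hk.
  destruct j as [|[|[|[|j]]]]; [| | | |lia]; (destruct k as [|[|[|[|k]]]]; [| | | |lia]);
    try reflexivity; rewrite ?E0, ?E1, ?E2, ?E3; unfold near;
    intros (A1 & A2 & A3) (B1 & B2 & B3); exfalso;
    apply Rabs_def2 in A1, A2, A3, B1, B2, B3; lra.
Qed.

(** Nonnegativity makes 19/2 the least of the four squared lengths once one of their parameters
    vanishes. *)
Definition box (t : nat -> R) : Prop := forall k, 0 <= t k <= 1/1000.

Lemma skew_bound (p q : R) : 0 <= p <= 1/1000 -> 0 <= q <= 1/1000 ->
  -1/1000 <= skew p q <= 1/1000.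
Proof. unfold skew; lra. Qed.

Lemma height_sqr (p q : R) : 0 <= p <= 1/1000 -> 0 <= q <= 1/1000 ->
  6 * (height p q)^2 = 3/2 + (p + q)/2 - 2 * (skew p q)^2.
Proof.
  intros Hp Hq; pose proof (skew_bound p q Hp Hq).
  unfold height; rewrite pow2_sqrt; [field | nra].
Qed.

Lemma height_bound (p q : R) : 0 <= p <= 1/1000 -> 0 <= q <= 1/1000 ->
  499/1000 <= height p q <= 501/1000.
Proof.
  intros Hp Hq; pose proof (skew_bound p q Hp Hq); pose proof (height_sqr p q Hp Hq).
  assert (0 <= height p q) by apply sqrt_pos.
  split; nra.
Qed.

Lemma height_lipschitz (p q p' q' r : R) :
  0 <= p <= 1/1000 -> 0 <= q <= 1/1000 -> 0 <= p' <= 1/1000 -> 0 <= q' <= 1/1000 ->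
  Rabs (p' - p) < r -> Rabs (q' - q) < r -> Rabs (height p' q' - height p q) < r.
Proof.
  intros Hp Hq Hp' Hq' H1 H2.
  pose proof (height_sqr p q Hp Hq) as S; pose proof (height_sqr p' q' Hp' Hq') as S'.
  pose proof (height_bound p q Hp Hq); pose proof (height_bound p' q' Hp' Hq').
  pose proof (skew_bound p q Hp Hq); pose proof (skew_bound p' q' Hp' Hq').
  apply Rabs_def2 in H1, H2.
  assert (E : skew p' q' - skew p q = ((p' - p) - (q' - q)) / 16) by (unfold skew; field).
  set (h := height p q) in *; set (h' := height p' q') in *.
  set (s := skew p q) in *; set (s' := skew p' q') in *; clearbody h h' s s'.
  (* The right side is below [3 * r] in absolute value, while [h' + h] is close to 1. *)
  assert (D : 6 * ((h' - h) * (h' + h)) = ((p' - p) + (q' - q))/2 - 2 * ((s' - s) * (s' + s))) by lra.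
  assert (-r <= s' - s <= r) by lra.
  assert (-r <= (s' - s) * (s' + s) <= r) by nra.
  apply Rabs_def1; nra.
Qed.

Lemma start_finish_onH (t : nat -> R) : onH (start t) /\ onH (finish t).
Proof. unfold start, finish; simpl; split; field. Qed.

Lemma start_finish_lipschitz (t t' : nat -> R) (r : R) : box t -> box t' ->
  (forall k, Rabs (t' k - t k) < r) ->
  eucl (start t) (start t') <= 4 * r /\ eucl (finish t) (finish t') <= 4 * r.
Proof.
  intros Ht Ht' H.
  pose proof (height_lipschitz _ _ _ _ r (Ht 0%nat) (Ht 1%nat) (Ht' 0%nat) (Ht' 1%nat) (H _) (H _)) as Hh.
  pose proof (height_lipschitz _ _ _ _ r (Ht 2%nat) (Ht 3%nat) (Ht' 2%nat) (Ht' 3%nat) (H _) (H _)) as Hh'.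
  pose proof (H 0%nat) as H0; pose proof (H 1%nat) as H1.
  pose proof (H 2%nat) as H2; pose proof (H 3%nat) as H3.
  apply Rabs_def2 in Hh, Hh', H0, H1, H2, H3.
  assert (L : forall x y z, -2*r <= x <= 2*r -> -2*r <= y <= 2*r -> -2*r <= z <= 2*r ->
    x^2 + y^2 + z^2 <= (4*r)^2) by (intros; nra).
  split; (apply eucl_le_sqr; [lra|]); unfold start, finish, skew, dist2; apply L; lra.
Qed.

Lemma start_finish_lift_dist2 (t : nat -> R) (k : nat) : box t -> (k < 4)%nat ->
  dist2 (start t) (finish_lift t k) = 19/2 + t k.
Proof.
  intros Ht Hk.
  pose proof (height_sqr _ _ (Ht 0%nat) (Ht 1%nat)) as S.
  pose proof (height_sqr _ _ (Ht 2%nat) (Ht 3%nat)) as S'.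
  destruct k as [|[|[|[|k]]]]; [| | | |lia]; unfold start, finish_lift, finish, dist2;
    unfold skew in *; lra.
Qed.

Lemma mid_lift_near (t : nat -> R) (k : nat) : box t -> (k < 4)%nat ->
  near (1/40) (segment (start t) (finish_lift t k) (1/2)) (mid_lift k).
Proof.
  intros Ht Hk.
  pose proof (height_bound _ _ (Ht 0%nat) (Ht 1%nat)).
  pose proof (height_bound _ _ (Ht 2%nat) (Ht 3%nat)).
  pose proof (skew_bound _ _ (Ht 0%nat) (Ht 1%nat)).
  pose proof (skew_bound _ _ (Ht 2%nat) (Ht 3%nat)).
  destruct k as [|[|[|[|k]]]]; [| | | |lia]; unfold start, finish_lift, finish, near, segment;
    cbn; repeat split; apply Rabs_def1; lra.
Qed.

Lemma sqr_ge_of_far (v r : R) : 0 <= r -> v <= -r \/ r <= v -> r^2 <= v^2.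
Proof. intros Hr [H | H]; nra. Qed.

(** Outside [k] in {0, -1} and [l], [m] in {0, 1}, one coordinate alone has absolute value at least
    49/10. Sum zero then leaves the two named periods and (-1, 0, 1), which is bounded directly. *)
Lemma two_nearest_periods (x y z : R) (k l m : Z) :
  24/10 <= x <= 26/10 -> -16/10 <= y <= -14/10 -> -11/10 <= z <= -9/10 ->
  (k + l + m = 0)%Z ->
  (k = 0 /\ l = 0 /\ m = 0)%Z \/ (k = -1 /\ l = 1 /\ m = 0)%Z \/
  11 <= (x + 4 * IZR k)^2 + (y + 4 * IZR l)^2 + (z + 4 * IZR m)^2.
Proof.
  intros Hx Hy Hz Hs.
  assert (Far : forall v, v <= -49/10 \/ 49/10 <= v -> 11 <= v^2).
  { intros v Hv; pose proof (sqr_ge_of_far v (49/10) ltac:(lra) ltac:(lra)); lra. }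
  assert (Ck : (k = 0 \/ k = -1 \/ 1 <= k \/ k <= -2)%Z) by lia.
  assert (Cl : (l = 0 \/ l = 1 \/ l <= -1 \/ 2 <= l)%Z) by lia.
  assert (Cm : (m = 0 \/ m = 1 \/ m <= -1 \/ 2 <= m)%Z) by lia.
  pose proof (pow2_ge_0 (x + 4 * IZR k)); pose proof (pow2_ge_0 (y + 4 * IZR l)).
  pose proof (pow2_ge_0 (z + 4 * IZR m)).
  destruct Ck as [Ck | [Ck | [Ck | Ck]]];
    [| | apply IZR_le in Ck; do 2 right; pose proof (Far (x + 4 * IZR k)); lra
    | apply IZR_le in Ck; do 2 right; pose proof (Far (x + 4 * IZR k)); lra].
  all: destruct Cl as [Cl | [Cl | [Cl | Cl]]];
    [| | apply IZR_le in Cl; do 2 right; pose proof (Far (y + 4 * IZR l)); lra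
    | apply IZR_le in Cl; do 2 right; pose proof (Far (y + 4 * IZR l)); lra].
  all: destruct Cm as [Cm | [Cm | [Cm | Cm]]];
    [| | apply IZR_le in Cm; do 2 right; pose proof (Far (z + 4 * IZR m)); lra
    | apply IZR_le in Cm; do 2 right; pose proof (Far (z + 4 * IZR m)); lra].
  all: subst; try lia.
  do 2 right.
  pose proof (sqr_ge_of_far (x + 4 * IZR (-1)) (14/10) ltac:(lra) ltac:(lra)).
  pose proof (sqr_ge_of_far y (14/10) ltac:(lra) ltac:(lra)).
  pose proof (sqr_ge_of_far (z + 4 * IZR 1) (29/10) ltac:(lra) ltac:(lra)).
  replace (y + 4 * 0) with y by ring; lra.
Qed.

Lemma four_nearest_lifts (t : nat -> R) (b : pt) : box t -> onH b -> foldT b = foldT (finish t) ->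
  (exists k, (k < 4)%nat /\ b = finish_lift t k) \/ 11 <= dist2 (start t) b.
Proof.
  intros Ht Hb E.
  pose proof (height_bound _ _ (Ht 0%nat) (Ht 1%nat)).
  pose proof (height_bound _ _ (Ht 2%nat) (Ht 3%nat)).
  pose proof (skew_bound _ _ (Ht 0%nat) (Ht 1%nat)).
  pose proof (skew_bound _ _ (Ht 2%nat) (Ht 3%nat)).
  destruct (foldT_fiber (finish t) b (proj2 (start_finish_onH t)) Hb (eq_sym E))
    as (s & k & l & m & Hs & ->).
  unfold finish_lift; unfold finish, start in *.
  set (h := height (t 0%nat) (t 1%nat)) in *; set (h' := height (t 2%nat) (t 3%nat)) in *.
  set (u := skew (t 0%nat) (t 1%nat)) in *; set (u' := skew (t 2%nat) (t 3%nat)) in *.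
  clearbody h h' u u'; cbn -[pow] in *; destruct Hs as [-> | ->].
  - assert (Hsum : (k + l + m = 0)%Z) by (apply eq_IZR; rewrite !plus_IZR; lra).
    destruct (two_nearest_periods (2 + u + h) (-2 - u + h) (-2*h) (-k) (-l) (-m)) as [P | [P | P]];
      try lra; try lia.
    + left; exists 0%nat; split; [lia|].
      replace k with 0%Z by lia; replace l with 0%Z by lia; replace m with 0%Z by lia.
      apply pt_eq; lra.
    + left; exists 1%nat; split; [lia|].
      replace k with 1%Z by lia; replace l with (-1)%Z by lia; replace m with 0%Z by lia.
      apply pt_eq; lra.
    + right; rewrite !opp_IZR in P; lra.
  - assert (Hsum : (k + l + m = -2)%Z) by (apply eq_IZR; rewrite !plus_IZR; lra).
    (* The displacement is read in the order [y], [z], [x]; the constants of the half-turn shift the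
       periods of [y] and [z] by one. *)
    destruct (two_nearest_periods (2 + u' + h') (-2 - u' + h') (-2*h') (-l - 1) (-m - 1) (-k))
      as [P | [P | P]]; try lra; try lia.
    + left; exists 2%nat; split; [lia|].
      replace k with 0%Z by lia; replace l with (-1)%Z by lia; replace m with (-1)%Z by lia.
      apply pt_eq; lra.
    + left; exists 3%nat; split; [lia|].
      replace k with 0%Z by lia; replace l with 0%Z by lia; replace m with (-2)%Z by lia.
      apply pt_eq; lra.
    + right; rewrite !minus_IZR, !opp_IZR in P; lra.
Qed.

(** Apollonius's median formula: a point almost halfway along an almost shortest broken line is near
    the midpoint. *)
Lemma segment_mid_dist2 (a b c : pt) :
  4 * dist2 c (segment a b (1/2)) = 2 * dist2 a c + 2 * dist2 c b - dist2 a b.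
Proof.
  destruct a as [[a1 a2] a3], b as [[b1 b2] b3], c as [[c1 c2] c3]; simpl; field.
Qed.

Lemma positive_values_bounded_below (t : nat -> R) (n : nat) : (forall k, 0 <= t k) ->
  exists e, 0 < e /\ forall k, (k < n)%nat -> t k = 0 \/ e <= t k.
Proof.
  intros Ht; induction n as [|n (e & He & IH)].
  - exists 1; split; [lra | lia].
  - destruct (Req_dec (t n) 0) as [Z | Z].
    + exists e; split; [exact He|]; intros k Hk.
      destruct (Nat.eq_dec k n) as [-> |]; [auto | apply IH; lia].
    + pose proof (Ht n); exists (Rmin e (t n)); split; [apply Rmin_glb_lt; lra|].
      intros k Hk; pose proof (Rmin_l e (t n)); pose proof (Rmin_r e (t n)).
      destruct (Nat.eq_dec k n) as [-> |]; [auto|].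
      destruct (IH k) as [E | E]; [lia | auto | right; lra].
Qed.

(* Every minimal geodesic is close to a shortest segment between lifts, so only the
   types [k] with [t k = 0] occur. *)
Lemma midpoint_near (t : nat -> R) (g : R -> pt) (j : nat) :
  box t -> (j < 4)%nat -> t j = 0 ->
  minimal_geodesic (foldT (start t)) (foldT (finish t)) g ->
  exists k, (k < 4)%nat /\ t k = 0 /\ near (1/20) (g (1/2)) (mid k).
Proof.
  intros Ht Hj Hj0 (G0 & G1 & Gin & Gd).
  destruct (start_finish_onH t) as [Ha Hb].
  assert (Hm : inT (g (1/2))) by (apply Gin; lra).
  set (d := dT (foldT (start t)) (foldT (finish t))) in *.
  assert (D1 : dT (foldT (start t)) (g (1/2)) = d/2).
  { rewrite <- G0, Gd by lra; rewrite Rabs_left by lra; lra. }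
  assert (D2 : dT (g (1/2)) (foldT (finish t)) = d/2).
  { rewrite <- G1, Gd by lra; rewrite Rabs_left by lra; lra. }
  assert (Hlift : forall k, (k < 4)%nat ->
    onH (finish_lift t k) /\ foldT (finish_lift t k) = foldT (finish t)).
  { intros k Hk; unfold finish_lift; destruct (finish t) as [[x y] z]; simpl in Hb.
    destruct k as [|[|[|k]]].
    - split; [exact Hb | reflexivity].
    - split; [simpl; lra|]; rewrite <- (foldT_deck 1 1 (-1) 0 (x, y, z)) by (left; reflexivity).
      f_equal; apply pt_eq; lra.
    - split; [simpl; lra|]; rewrite <- (foldT_deck (-1) 0 (-1) (-1) (x, y, z)) by (right; reflexivity).
      f_equal; apply pt_eq; lra.
    - split; [simpl; lra|]; rewrite <- (foldT_deck (-1) 0 0 (-2) (x, y, z)) by (right; reflexivity).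
      f_equal; apply pt_eq; lra. }
  assert (Hd : forall b, onH b -> foldT b = foldT (finish t) -> d <= eucl (start t) b).
  { intros b Hb' Eb; unfold d; rewrite <- Eb; apply dT_le_eucl_lift; assumption. }
  assert (Hd0 : 0 <= d).
  { unfold d; eapply Rle_trans; [|apply eucl_le_dT; apply foldT_inT; assumption].
    apply eucl_ge_0. }
  assert (Hd2 : d^2 <= 19/2).
  { destruct (Hlift j Hj) as [A B]; specialize (Hd _ A B).
    pose proof (start_finish_lift_dist2 t j Ht Hj) as S; rewrite <- eucl_sqr in S.
    pose proof (eucl_ge_0 (start t) (finish_lift t j)); nra. }
  assert (Hd3 : d <= 31/10) by nra.
  destruct (positive_values_bounded_below t 4 (fun k => proj1 (Ht k))) as (e0 & He0 & Hmin).
  (* As [d <= 31/10], squaring [d + 2 * e] adds less than [14 * e], hence less than each positive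
     [t k] with [k < 4]; the bound 1/10000 brings the midpoint error below 1/40. *)
  set (e := Rmin (e0/14) (1/10000)).
  assert (He : 0 < e) by (apply Rmin_glb_lt; lra).
  assert (He1 : 14 * e <= e0) by (pose proof (Rmin_l (e0/14) (1/10000)); unfold e; lra).
  assert (He2 : e <= 1/10000) by apply Rmin_r.
  (* Lifting the midpoint first and the endpoint from there gives a broken line of length below
     [d + 2 * e]. *)
  destruct (lift_almost_minimal (start t) (g (1/2)) e Ha Hm He) as (c & Hc & Ec & Lc).
  destruct (lift_almost_minimal c (foldT (finish t)) e Hc (foldT_inT _ Hb) He)
    as (b & Hb' & Eb & Lb).
  rewrite Ec in Lb; rewrite D1 in Lc; rewrite D2 in Lb.
  pose proof (eucl_triangle (start t) c b); pose proof (Hd b Hb' Eb).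
  pose proof (eucl_ge_0 (start t) c); pose proof (eucl_ge_0 c b).
  assert (Hab : dist2 (start t) b < 19/2 + 14 * e) by (rewrite <- eucl_sqr; nra).
  destruct (four_nearest_lifts t b Ht Hb' Eb) as [(k & Hk & ->) | N]; [|lra].
  rewrite start_finish_lift_dist2 in Hab by assumption.
  exists k; split; [exact Hk|]; split.
  { destruct (Hmin k Hk); [assumption | lra]. }
  assert (Hcm : near (1/40) c (segment (start t) (finish_lift t k) (1/2))).
  { apply near_of_dist2; [lra|].
    pose proof (segment_mid_dist2 (start t) (finish_lift t k) c) as P.
    rewrite <- (eucl_sqr (start t)), <- (eucl_sqr c (finish_lift t k)), <- (eucl_sqr (start t)) in P.
    assert (d * e <= 31/10 * e) by (apply Rmult_le_compat_r; lra).
    assert (e * e <= 1/10000 * e) by (apply Rmult_le_compat_r; lra).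
    assert ((eucl (start t) c)^2 <= (d/2 + e)^2) by (apply pow_incr; lra).
    assert ((eucl c (finish_lift t k))^2 <= (d/2 + e)^2) by (apply pow_incr; lra).
    assert (d^2 <= (eucl (start t) (finish_lift t k))^2) by (apply pow_incr; lra).
    lra. }
  rewrite <- Ec; apply foldT_near; replace (1/20) with (1/40 + 1/40) by lra.
  eapply near_trans; [exact Hcm | apply mid_lift_near; assumption].
Qed.

(** * Excluding the domains one after the other *)

(** Continuity keeps the chosen midpoint near [mid k], while at [t'] it is near some [mid k'] with
    [t' k' = 0]; the total error 1/8 forces [k = k']. *)
Lemma rule_midpoint_stable (E : pt -> pt -> Prop) (phi : pt -> pt -> R -> pt)
  (t : nat -> R) (k : nat) :
  GMPR E phi -> box t -> (k < 4)%nat -> E (foldT (start t)) (foldT (finish t)) ->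
  near (1/20) (phi (foldT (start t)) (foldT (finish t)) (1/2)) (mid k) ->
  exists r, 0 < r /\ forall t' j, box t' -> (j < 4)%nat -> t' j = 0 ->
    (forall i, Rabs (t' i - t i) < r) ->
    E (foldT (start t')) (foldT (finish t')) -> t' k = 0.
Proof.
  intros [Hgeo Hcont] Ht Hk HE Hnear.
  destruct (Hcont _ _ HE (1/40) ltac:(lra)) as (d & Hd & Hclose).
  (* The endpoints move by at most four times the radius, hence by less than [d]. *)
  exists (d/5); split; [lra|]; intros t' j Ht' Hj Hj0 Hr HE'.
  destruct (start_finish_onH t) as [Ha Hb], (start_finish_onH t') as [Ha' Hb'].
  destruct (start_finish_lipschitz t t' (d/5) Ht Ht' Hr) as [L1 L2].
  pose proof (dT_le_eucl_lift _ _ Ha Ha'); pose proof (dT_le_eucl_lift _ _ Hb Hb').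
  specialize (Hclose _ _ HE' ltac:(lra) ltac:(lra) (1/2) ltac:(lra)).
  destruct (midpoint_near t' _ j Ht' Hj Hj0 (Hgeo _ _ HE')) as (k' & Hk' & Hk0 & Hnear').
  assert (Hin : inT (phi (foldT (start t)) (foldT (finish t)) (1/2)))
    by (apply (Hgeo _ _ HE); lra).
  assert (Hin' : inT (phi (foldT (start t')) (foldT (finish t')) (1/2)))
    by (apply (Hgeo _ _ HE'); lra).
  pose proof (eucl_le_dT _ _ Hin Hin') as Hpp.
  assert (Hpp' := near_of_eucl _ _ _ (Rle_lt_trans _ _ _ Hpp Hclose)).
  assert (k = k') as ->; [|exact Hk0].
  apply (mid_inj (phi (foldT (start t)) (foldT (finish t)) (1/2)) (1/20) (1/40 + 1/20));
    [lra | exact Hk | exact Hk' | exact Hnear | exact (near_trans _ _ _ _ _ Hpp' Hnear')].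
Qed.

(* [I] lists domains already excluded near [t], and [K] the coordinates raised to
   exclude them: the rule on a domain containing the pair at [t] selects a type [k]
   with [t k = 0], and raising [t k] makes that type longer than the minimum. *)
Lemma exclude_domains (E : nat -> pt -> pt -> Prop) (phi : nat -> pt -> pt -> R -> pt) (N n : nat) :
  (forall i, (i < N)%nat -> GMPR (E i) (phi i)) ->
  (forall x y, inT x -> inT y -> exists i, (i < N)%nat /\ E i x y) ->
  (n <= 4)%nat ->
  exists (t : nat -> R) (r : R) (I K : list nat),
    length I = n /\ NoDup I /\ incl I (seq 0 N) /\ length K = n /\
    box t /\ (forall k, ~ In k K -> t k = 0) /\ (forall k, In k K -> 0 < t k) /\ 0 < r /\
    forall t' j, box t' -> (j < 4)%nat -> t' j = 0 -> (forall i, Rabs (t' i - t i) < r) ->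
      (forall k, In k K -> 0 < t' k) ->
      forall i, In i I -> ~ E i (foldT (start t')) (foldT (finish t')).
Proof.
  intros HG Hcover; induction n as [|n IH]; intros Hn.
  - exists (fun _ => 0), 1, [], []; simpl.
    split; [reflexivity|]; split; [constructor|]; split; [apply incl_nil_l|].
    split; [reflexivity|]; split; [intros k; lra|]; split; [reflexivity|].
    split; [tauto|]; split; [lra | tauto].
  - destruct (IH ltac:(lia)) as (t & r & I & K & LI & NI & II & LK & Ht & HK0 & HK & Hr & Hex).
    (* Fewer than four coordinates have been raised, so some geodesic type still has squared length
       19/2. *)
    assert (exists j, (j < 4)%nat /\ ~ In j K) as (j & Hj & HjK).
    { apply NNPP; intros C.
      assert (incl (seq 0 4) K) as Hincl.
      { intros j Hj; apply in_seq in Hj; apply NNPP; intros D.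
        apply C; exists j; split; [lia | exact D]. }
      apply (NoDup_incl_length (seq_NoDup 4 0)) in Hincl; rewrite length_seq in Hincl; lia. }
    destruct (start_finish_onH t) as [Ha Hb].
    destruct (Hcover _ _ (foldT_inT _ Ha) (foldT_inT _ Hb)) as (i & Hi & HEi).
    assert (HiI : ~ In i I).
    { intros C; apply (Hex t j Ht Hj (HK0 j HjK)) in HEi; try assumption.
      intros l; rewrite Rminus_diag, Rabs_R0; exact Hr. }
    destruct (midpoint_near t _ j Ht Hj (HK0 j HjK) (proj1 (HG i Hi) _ _ HEi))
      as (k & Hk & Hk0 & Hnear).
    destruct (rule_midpoint_stable _ _ t k (HG i Hi) Ht Hk HEi Hnear) as (r' & Hr' & Hst).
    assert (HkK : ~ In k K) by (intros C; apply HK in C; lra).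
    pose (m := Rmin (Rmin r r') (1/1000)).
    assert (Hm : 0 < m) by (repeat apply Rmin_glb_lt; lra).
    assert (Hm1 : m <= 1/1000) by apply Rmin_r.
    assert (Hmr : m <= r /\ m <= r').
    { pose proof (Rmin_l (Rmin r r') (1/1000)); pose proof (Rmin_l r r').
      pose proof (Rmin_r r r'); unfold m; lra. }
    (* Raising by half of [m] leaves an [m/2]-ball around [t1] inside the [m]-ball around [t], where
       both the old exclusions and the new one apply. *)
    pose (t1 := fun l => if Nat.eq_dec l k then m/2 else t l).
    assert (Hclose : forall t', (forall l, Rabs (t' l - t1 l) < m/2) ->
      forall l, Rabs (t' l - t l) < m).
    { intros t' H l; specialize (H l); unfold t1 in H.
      destruct (Nat.eq_dec l k) as [-> |]; [|lra].
      apply Rabs_def2 in H; apply Rabs_def1; lra. }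
    exists t1, (m/2), (i :: I), (k :: K).
    split; [simpl; lia|]; split; [constructor; assumption|].
    split; [apply incl_cons; [apply in_seq; lia | exact II]|]; split; [simpl; lia|].
    split; [intros l; unfold t1; destruct (Nat.eq_dec l k); [lra | apply Ht]|].
    split; [|split; [|split; [lra|]]].
    + intros l Hl; unfold t1; destruct (Nat.eq_dec l k) as [-> |].
      * exfalso; apply Hl; left; reflexivity.
      * apply HK0; intros C; apply Hl; right; exact C.
    + intros l [<- | Hl]; unfold t1.
      * destruct (Nat.eq_dec k k); [lra | congruence].
      * destruct (Nat.eq_dec l k); [lra | apply HK, Hl].
    + intros t' j' Ht' Hj' Hj0' Hd Hpos i' Hi' HE'.
      specialize (Hclose t' Hd).
      destruct Hi' as [<- | Hi'].
      * assert (t' k = 0).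
        { apply (Hst t' j'); try assumption; intros l; specialize (Hclose l); lra. }
        specialize (Hpos k (or_introl eq_refl)); lra.
      * apply (Hex t' j' Ht' Hj' Hj0') in HE'; try assumption.
        -- intros l; specialize (Hclose l); lra.
        -- intros l Hl; apply Hpos; right; exact Hl.
Qed.

Theorem theorem4p1 :
  ~ exists (E1 E2 E3 : pt -> pt -> Prop) (phi1 phi2 phi3 : pt -> pt -> R -> pt),
      partition3 E1 E2 E3 /\ GMPR E1 phi1 /\ GMPR E2 phi2 /\ GMPR E3 phi3.
Proof.
  intros (E1 & E2 & E3 & phi1 & phi2 & phi3 & (_ & Hcover & _) & G1 & G2 & G3).
  destruct (exclude_domains
    (fun i => match i with 0%nat => E1 | 1%nat => E2 | _ => E3 end)
    (fun i => match i with 0%nat => phi1 | 1%nat => phi2 | _ => phi3 end) 3 4)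
    as (t & r & I & K & LI & NI & II & _).
  - intros [|[|i]] _; assumption.
  - intros x y Hx Hy; destruct (Hcover x y Hx Hy) as [H | [H | H]];
      [exists 0%nat | exists 1%nat | exists 2%nat]; split; auto.
  - lia.
  (* Four rounds would yield four distinct indices below 3. *)
  - apply (NoDup_incl_length NI) in II; rewrite length_seq in II; lia.
Qed.
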